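(* Fix $a>0$. For each $n\ge1$ let $b_n>0$, and suppose that we observe $X_{1,n},\dots,X_{n,n}$ i.i.d. with density $p_{g,b_n}=f_{b_n}*g$, where $f_{b_n}(x)=\frac{1}{2b_n}e^{-|x|/b_n}$ and $g\in\mathcal P([-a,a])$. Let $\mathbb P_g^n$ denote the joint distribution of $(X_{1,n},\dots,X_{n,n})$ under $g$. Assume that there is a constant $c>0$ such that $b_n\ge c\sqrt n$ for all sufficiently large $n$. Then for every sequence of estimators $g_n^\star=g_n^\star(X_{1,n},\dots,X_{n,n})$, $$\liminf_{n\to\infty}\ \sup_{g\in\mathcal P([-a,a])}\mathbb P_g^n\left(W_1(g_n^\star,g)\ge a\right)\ \ge\ \frac14\exp\left(-\frac{2a^2}{c^2}\right)>0.$$ Consequently, there is no estimator sequence $g_n^\star$ such that $W_1(g_n^\star,g)\to0$ in $\mathbb P_g^n$-probability for every $g\in\mathcal P([-a,a])$. Equivalently, writing $\epsilon_n=2a/b_n$, if $\epsilon_n\lesssim n^{-1/2}$ (that is, $\epsilon_n\le C n^{-1/2}$ for some constant $C$ and all sufficiently large $n$), then no estimator sequence can satisfy $W_1(g_n^\star,g)\to 0$ in $\mathbb P_g^n$-probability for every $g\in\mathcal P([-a,a])$.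
   Context: $\mathcal P([-a,a])$ is the set of all Borel probability measures on $[-a,a]$. $(f_b*g)(x)=\int f_b(x-\theta)\,g(\mathrm d\theta)$. $W_1$ is the 1-Wasserstein distance on probability measures on $\mathbb R$ with finite first moment. An estimator is a measurable function of the sample with values in such probability measures. *)

(* Defs.v *)
From HB Require Import structures.
From mathcomp Require Import all_boot all_order all_algebra.
From mathcomp Require Import all_classical all_reals all_analysis.
From mathcomp Require Import measurable_realfun.

Set Implicit Arguments.
Unset Strict Implicit.
Unset Printing Implicit Defensive.

Import Order.TTheory GRing.Theory Num.Theory.
Import numFieldNormedType.Exports.

Local Open Scope classical_set_scope.
Local Open Scope ring_scope.

Section product_law.
Context d (T : measurableType d) (R : realType).

Definition tcons n (z : T * n.-tuple T) : n.+1.-tuple T :=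
  [the n.+1.-tuple T of z.1 :: z.2].

Lemma measurable_tcons n : measurable_fun [set: T * n.-tuple T] (@tcons n).
Proof. by apply: measurable_cons. Qed.

HB.instance Definition _ n :=
  isMeasurableFun.Build _ _ _ _ (@tcons n) (@measurable_tcons n).

Section product_probability.
Context d1 d2 (T1 : measurableType d1) (T2 : measurableType d2).
Variables (P : probability T1 R) (Q : probability T2 R).

Definition pprod : set (T1 * T2) -> \bar R := (P \x Q)%E.

HB.instance Definition _ := Measure.on pprod.

Let pprod_setT : pprod setT = 1%E.
Proof.
by rewrite /pprod -setXTT product_measure1E//= !probability_setT mule1.
Qed.

HB.instance Definition _ := Measure_isProbability.Build _ _ _ pprod pprod_setT.
End product_probability.

(* The law of [n] independent draws from [P], as a probability measure on the
   product sigma-algebra of [n.-tuple T]; see [iid_law_rectangle]. *)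
Fixpoint iid_law (P : probability T R) (n : nat) :
    probability (n.-tuple T) R :=
  match n with
  | 0 => dirac [tuple]
  | n'.+1 => distribution (pprod P (iid_law P n')) (@tcons n')
  end.

Lemma iid_law_rectangle (P : probability T R) n (A : 'I_n -> set T) :
  (forall i, measurable (A i)) ->
  iid_law P n [set x | forall i, A i (tnth x i)] = (\big[*%E/1]_(i < n) P (A i))%E.
Proof.
elim: n A => [|n IHn] A mA.
  by rewrite big_ord0 /= diracE mem_set//= => -[].
rewrite big_ord_recl -IHn//= /distribution /pushforward /=.
rewrite /pprod -product_measure1E//; last first.
  rewrite (_ : mkset _ =
      \bigcap_(i in [set: 'I_n]) ((@tnth n T)^~ i @^-1` A (lift ord0 i))).
    apply: fin_bigcap_measurable => // i _.
    by rewrite -[X in measurable X]setTI; exact: measurable_tnth.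
  by apply/seteqP; split=> x /= h i; [move=> _|]; exact: h.
congr (_ _); apply/seteqP; split=> -[x t] /=.
  move=> h; split; first exact: (h ord0).
  by move=> i; have := h (lift ord0 i); rewrite /tcons/= tnthS.
move=> [h0 h1] i; have [j ->|->] := unliftP ord0 i; last exact: h0.
by rewrite /tcons/= tnthS; exact: h1.
Qed.

End product_law.

Section laplace.
Context {R : realType}.
Local Notation mu := (@lebesgue_measure R).
Implicit Types (b : {posnum R}) (g : probability (measurableTypeR R) R).

Definition laplace_pdf b (x : R) : R :=
  (2 * b%:num)^-1 * expR (- `|x| / b%:num).

Definition convolution_pdf b g (x : R) : \bar R :=
  (\int[g]_theta (laplace_pdf b (x - theta))%:E)%E.

Definition obs_law b g (A : set (measurableTypeR R)) : \bar R :=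
  (\int[mu]_(x in A) convolution_pdf b g x)%E.

Lemma laplace_pdf_ge0 b x : 0 <= laplace_pdf b x.
Proof. by rewrite /laplace_pdf mulr_ge0 ?expR_ge0. Qed.

Lemma continuous_laplace_pdf b : continuous (laplace_pdf b).
Proof.
move=> x; apply: cvgM; first exact: cvg_cst.
apply: (cvg_comp _ expR); last exact: continuous_expR.
apply: cvgM; last exact: cvg_cst.
by apply: (@cvgN _ R^o); exact: (@norm_continuous _ R^o).
Qed.

Lemma measurable_laplace_pdf b :
  measurable_fun [set: measurableTypeR R] (laplace_pdf b).
Proof. by apply: continuous_measurable_fun; exact: continuous_laplace_pdf. Qed.

Lemma integral_laplace_pdf b : (\int[mu]_x (laplace_pdf b x)%:E = 1)%E.
Proof.
rewrite ge0_symfun_integralT; first last.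
- by move=> x /=; rewrite /laplace_pdf normrN.
- exact: continuous_laplace_pdf.
- exact: laplace_pdf_ge0.
have b0 : 0 < b%:num^-1 by [].
rewrite -set_itvcy -(integral_exponential_pdf b0).
rewrite [in RHS](_ : (fun x => _) = (fun x : R => 2%:E * (laplace_pdf b x)%:E)%E
  \_ `[0, +oo[%classic); last first.
  apply/funext => x; rewrite /exponential_pdf !patchE; case: ifPn => // x0.
  rewrite -EFinM /laplace_pdf; congr (_%:E).
  move: x0; rewrite inE/= in_itv/= andbT => x0.
  rewrite ger0_norm// mulrA invfM mulrA divff// mul1r; congr (_ * expR _).
  by rewrite !mulNr mulrC.
rewrite -integral_mkcond ge0_integralZl//.
- apply/measurable_EFinP; apply: measurable_funTS.
  exact: measurable_laplace_pdf.
- by move=> x _; rewrite lee_fin laplace_pdf_ge0.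
Qed.

Lemma integral_laplace_pdf_shift b (t : R) :
  (\int[mu]_x (laplace_pdf b (x - t))%:E = 1)%E.
Proof.
rewrite -[RHS](integral_laplace_pdf b).
have dE : (fun x : R => x - t)^`()%classic = cst 1.
  by apply/funext => x; rewrite derive1E derive_val subr0.
rewrite [RHS](@increasing_ge0_integration_by_substitutionT _ (fun x => x - t)).
- by apply: eq_integral => x _; rewrite dE !fctE/= mulr1.
- by move=> x y xy; rewrite ltrD2r.
- by rewrite dE; exact: cst_continuous.
- by rewrite dE; exact: is_cvg_cst.
- by rewrite dE; exact: is_cvg_cst.
- by move=> x; exact: derivableB.
- apply/cvgrNyPle => A; exists (A + t); split; first exact: num_real.
  by move=> x /ltW; rewrite lerBlDr.
- apply/cvgryPge => A; exists (A + t); split; first exact: num_real.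
  by move=> x /ltW; rewrite lerBrDr.
- exact: continuous_laplace_pdf.
- exact: laplace_pdf_ge0.
Qed.

Lemma measurable_laplace_pdf2 b :
  measurable_fun [set: measurableTypeR R * measurableTypeR R]
    (fun z => (laplace_pdf b (z.1 - z.2))%:E).
Proof.
apply/measurable_EFinP.
apply: (@measurableT_comp _ _ _ _ _ _ (laplace_pdf b)).
  exact: measurable_laplace_pdf.
by apply: measurable_funB; [exact: measurable_fst|exact: measurable_snd].
Qed.

Lemma convolution_pdf_ge0 b g x : (0 <= convolution_pdf b g x)%E.
Proof. by apply: integral_ge0 => t _; rewrite lee_fin laplace_pdf_ge0. Qed.

Lemma measurable_convolution_pdf b g :
  measurable_fun [set: measurableTypeR R] (convolution_pdf b g).
Proof.
apply: (@measurable_fun_fubini_tonelli_F _ _ _ _ _ g _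
  (@measurable_laplace_pdf2 b)) => z.
by rewrite lee_fin laplace_pdf_ge0.
Qed.

Section obs_law_probability.
Variables (b : {posnum R}) (g : probability (measurableTypeR R) R).
Local Notation P := (obs_law b g).

Let obs_law0 : P set0 = 0%E.
Proof. by rewrite /obs_law integral_set0. Qed.

Let obs_law_ge0 A : (0 <= P A)%E.
Proof. by apply: integral_ge0 => x _; exact: convolution_pdf_ge0. Qed.

Let obs_law_sigma_additive : semi_sigma_additive P.
Proof.
move=> /= F mF tF mUF; rewrite /obs_law; apply: cvg_toP.
  apply: ereal_nondecreasing_is_cvgn => m n mn.
  apply: lee_sum_nneg_natr => // k _ _; apply: integral_ge0 => /= x Fkx.
  exact: convolution_pdf_ge0.
rewrite ge0_integral_bigcup//=.
- by apply: measurable_funTS; exact: measurable_convolution_pdf.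
- by move=> x _; exact: convolution_pdf_ge0.
Qed.

HB.instance Definition _ := isMeasure.Build _ _ _
  P obs_law0 obs_law_ge0 obs_law_sigma_additive.

Let obs_law_setT : P [set: _] = 1%E.
Proof.
rewrite /obs_law /convolution_pdf.
rewrite (@fubini_tonelli _ _ _ _ _ mu g
  (fun z => (laplace_pdf b (z.1 - z.2))%:E)); first last.
- by move=> z; rewrite lee_fin laplace_pdf_ge0.
- exact: measurable_laplace_pdf2.
under eq_integral do rewrite /= integral_laplace_pdf_shift.
by rewrite integral_cst// mul1e; exact: probability_setT.
Qed.

HB.instance Definition _ := @Measure_isProbability.Build _ _ R P obs_law_setT.

End obs_law_probability.

(* [sample_law b g n] is the joint distribution of the [n] observations. *)
Definition sample_law b g (n : nat) :
    probability (n.-tuple (measurableTypeR R)) R :=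
  iid_law (obs_law b g) n.

End laplace.

Section wasserstein.
Context {R : realType}.
Local Notation RB := (measurableTypeR R).
Implicit Types (mu nu g : probability RB R).

Definition prob_on (a : R) : set (probability RB R) :=
  [set g : probability RB R | g `[- a, a]%classic = 1%E].

Definition finite_first_moment mu : Prop :=
  (\int[mu]_x `|x : R|%:E < +oo)%E.

Definition couplings mu nu : set (probability (RB * RB)%type R) :=
  [set pi : probability (RB * RB)%type R | forall A : set RB, measurable A ->
     pi (A `*` setT) = mu A /\ pi (setT `*` A) = nu A].

Definition W1 mu nu : \bar R :=
  ereal_inf [set \int[pi]_z `|(z.1 : R) - z.2|%:E | pi in couplings mu nu]%E.

End wasserstein.

Section estimation.
Context {R : realType}.
Local Notation RB := (measurableTypeR R).

(* [pprobability] carries the sigma-algebra generated by the evaluations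
   [m |-> m U], [U] Borel; on the measures with a finite first moment it is the
   Borel sigma-algebra of [W1]. *)
Definition estimator (n : nat) (e : n.-tuple RB -> pprobability RB R) : Prop :=
  measurable_fun setT e /\ forall x, finite_first_moment (e x).

(* The index 0 is immaterial: all statements below are asymptotic. *)
Definition estimator_sequence
    (e : forall n, n.-tuple RB -> pprobability RB R) : Prop :=
  forall n, estimator (e n).

Definition W1_consistent_at (b : nat -> {posnum R})
    (e : forall n, n.-tuple RB -> pprobability RB R)
    (g : probability RB R) : Prop :=
  forall eps : R, 0 < eps ->
    sample_law (b n) g n [set x | (eps%:E < W1 (e n x) g)%E] @[n --> \oo]
      --> 0%E.

Definition W1_consistent (a : R) (b : nat -> {posnum R})
    (e : forall n, n.-tuple RB -> pprobability RB R) : Prop :=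
  forall g, prob_on a g -> W1_consistent_at b e g.

End estimation.

(* Main.v *)
Require Import Defs.
From HB Require Import structures.
From mathcomp Require Import all_boot all_order all_algebra.
From mathcomp Require Import all_classical all_reals all_analysis.
From mathcomp Require Import ring lra measurable_realfun.

Set Implicit Arguments.
Unset Strict Implicit.
Unset Printing Implicit Defensive.

Import Order.TTheory GRing.Theory Num.Theory.
Import numFieldNormedType.Exports.

Local Open Scope classical_set_scope.
Local Open Scope ring_scope.

(** The two point masses [dirac (- a)] and [dirac a] are at [W1]-distance
    [2 * a], so no estimate is within less than [a] of both; an estimator with
    small error under both would therefore be a test telling the two samples
    apart.  But a Laplace density of scale [b] changes by a factor at most
    [expR (2 * a / b)] when its centre moves from [- a] to [a], so one
    observation carries information of order [(a / b) ^+ 2] only, and [n] of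
    them carry [n * (a / b) ^+ 2 <= a ^+ 2 / c ^+ 2]: the tests keep a total
    error bounded away from [0].

    Information is measured by the Hellinger affinity, the integral of
    [Num.sqrt (p * q)] for densities [p] and [q].  It is used in its dual form
    [affinity_ge]: the affinity is at least [k] as soon as
    [2 * k <= \int[P]_x f x + \int[Q]_x g x] for all nonnegative [f] and [g]
    with [f * g >= 1].  This form needs no density on the sample space, it
    tensorizes by integrating one variable at a time ([affinity_ge_pprod],
    [affinity_ge_iid]), and two-valued [f] and [g] turn it into a lower bound
    on the total error of a test ([affinity_ge_testing]).  For one observation,
    [affinity_ge_density] gives affinity at least [expR (- r ^+ 2)] when the
    log-likelihood ratio is bounded by [2 * r]; here [r = a / b].

    The Wasserstein side is elementary because the distance to a point mass is
    an explicit integral ([W1_dirac]); this makes it a measurable function of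
    the sample and gives the triangle inequality that is needed. *)

(** * A Gaussian bound on the hyperbolic cosine *)

(** For [1 <= `|x|] both exponents are at most [x ^+ 2].  For small [x],
    [expR (4 * z)] is bounded through [expR y >= 1 + y] by [(1 - z)^-1 ^+ 4],
    and the first-order terms cancel in the sum with [- z], which is thus at
    most [2 * (1 + x ^+ 2)]. *)
Lemma expRD_expRN_le (R : realType) (x : R) :
  expR x + expR (- x) <= 2 * expR (x ^+ 2).
Proof.
have [x1|x1] := leP 1 `|x|.
  have le_sq (y : R) : `|y| = `|x| -> expR y <= expR (x ^+ 2).
    move=> yx; rewrite ler_expR (le_trans (ler_norm y))// yx.
    by rewrite -[x ^+ 2]real_normK ?num_real// expr2 ler_peMl.
  by have := le_sq x erefl; have := le_sq (- x) (normrN x); lra.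
have [z xE] : exists z, x = 4 * z by exists (x / 4); field.
have z4 : `|z| < 4^-1.
  by move: x1; rewrite xE normrM [`|4|]ger0_norm// -ltr_pdivlMl// mulr1.
have [zl zu] : - 4^-1 < z /\ z < 4^-1 by move: z4; rewrite ltr_norml => /andP.
have expR4 (y : R) : `|y| < 4^-1 -> expR (4 * y) <= (1 - y)^-1 ^+ 4.
  rewrite ltr_norml => /andP[yl yu].
  rewrite expRM_natl.
  rewrite lerXn2r ?nnegrE ?expR_ge0 ?invr_ge0//; first by lra.
  rewrite -[expR y]invrK -expRN lef_pV2 ?posrE ?expR_gt0//; last by lra.
  exact: expR_ge1Dx.
have := expR4 z z4; have := expR4 (- z); rewrite normrN mulrN => /(_ z4) hN hP.
rewrite xE.
apply: (le_trans (lerD hP hN)).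
apply: (@le_trans _ _ (2 * (1 + (4 * z) ^+ 2))); last first.
  by rewrite ler_pM2l// expR_ge1Dx.
have -> : (1 - z)^-1 ^+ 4 + (1 - - z)^-1 ^+ 4 =
    2 * (1 + 6 * z ^+ 2 + z ^+ 4) / (1 - z ^+ 2) ^+ 4.
  field.
  by rewrite ?andbA; do ?[apply/andP; split]; rewrite gt_eqF//; nra.
have w0 : 0 <= z ^+ 2 by exact: sqr_ge0.
have w1 : z ^+ 2 <= 16^-1 by nra.
rewrite ler_pdivrMr; last by apply: exprn_gt0; lra.
rewrite -mulrA ler_pM2l//.
have -> : z ^+ 4 = (z ^+ 2) ^+ 2 by rewrite -exprM.
rewrite [(4 * z) ^+ 2]exprMn; move: (z ^+ 2) w0 w1 => w w0 w1.
have bern : 1 - 4 * w <= (1 - w) ^+ 4.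
  have -> : (1 - w) ^+ 4 = 1 - 4 * w + w ^+ 2 * (6 - 4 * w + w ^+ 2) by ring.
  rewrite lerDl mulr_ge0 ?sqr_ge0//; have := sqr_ge0 w; lra.
apply: (@le_trans _ _ ((1 + 4 ^+ 2 * w) * (1 - 4 * w))); first by nra.
by apply: ler_wpM2l => //; lra.
Qed.

(** * Hellinger affinity in dual form *)

Section affinity.
Context d (T : measurableType d) (R : realType).
Implicit Types P Q : probability T R.
Local Open Scope ereal_scope.

(** The condition on [f] and [g] is [f x * g x >= 1], written through the
    arithmetic-geometric inequality: this avoids the products [0 * +oo] and
    makes the condition homogeneous, which is what tensorization needs. *)
Definition affinity_ge P Q (k : R) := forall f g : T -> \bar R,
  measurable_fun setT f -> measurable_fun setT g ->
  (forall x, 0 <= f x) -> (forall x, 0 <= g x) ->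
  (forall x t, (0 < t)%R -> 2%:E <= t%:E * f x + t^-1%:E * g x) ->
  (2 * k)%:E <= \int[P]_x f x + \int[Q]_x g x.

Lemma affinity_ge_scaled P Q k : affinity_ge P Q k ->
  forall f g : T -> \bar R,
  measurable_fun setT f -> measurable_fun setT g ->
  (forall x, 0 <= f x) -> (forall x, 0 <= g x) ->
  (forall x t, (0 < t)%R -> 2%:E <= t%:E * f x + t^-1%:E * g x) ->
  forall t, (0 < t)%R ->
  (2 * k)%:E <= t%:E * \int[P]_x f x + t^-1%:E * \int[Q]_x g x.
Proof.
move=> PQ f g mf mg f0 g0 fg t t0.
have ti0 : (0 <= t^-1)%R by rewrite invr_ge0 ltW.
rewrite -!ge0_integralZl ?lee_fin ?(ltW t0)//.
apply: PQ.
- exact: measurable_funeM.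
- exact: measurable_funeM.
- by move=> x; rewrite mule_ge0// lee_fin ltW.
- by move=> x; rewrite mule_ge0// lee_fin.
- move=> x s s0; rewrite !muleA -!EFinM -invfM.
  by apply: fg; rewrite mulr_gt0.
Qed.

(** Both [f] and [g] take the values [l^-1] and [l], with [l = k / 2], in
    opposite order on [A] and its complement.  The two integrals then add up to
    at most [l^-1 * (P A + Q (~` A)) + 2 * l], which [affinity_ge] compares
    with [2 * k = 4 * l]. *)
Lemma affinity_ge_testing P Q k (A : set T) : (0 < k)%R -> affinity_ge P Q k ->
  measurable A -> (k ^+ 2 / 2)%:E <= P A + Q (~` A).
Proof.
move=> k0 PQ mA.
have [l l0 kE] : exists2 l : R, (0 < l)%R & (k = 2 * l)%R.
  by exists (k / 2)%R; [rewrite divr_gt0|field].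
have li0 : (0 < l^-1)%R by rewrite invr_gt0.
have mC := measurableC mA.
pose step (B : set T) (x : T) : \bar R := (l^-1 * \1_B x + l * \1_(~` B) x)%:E.
have mstep B : measurable B -> measurable_fun setT (step B).
  move=> mB; apply/measurable_EFinP; apply: measurable_funD.
    by apply: measurable_funM => //; exact: measurable_indic.
  by apply: measurable_funM => //; apply: measurable_indic; exact: measurableC.
have stepE B x : step B x = if x \in B then l^-1%:E else l%:E.
  rewrite /step !indicE in_setC; case: (x \in B) => /=.
    by rewrite mulr1 mulr0 addr0.
  by rewrite mulr1 mulr0 add0r.
have step0 B x : 0 <= step B x by rewrite stepE; case: ifP; rewrite lee_fin ltW.
have int_step (W : probability T R) B : measurable B ->
    \int[W]_x step B x <= l^-1%:E * W B + l%:E.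
  move=> mB; have mBC := measurableC mB.
  under eq_integral do rewrite /step EFinD (EFinM l^-1) (EFinM l).
  rewrite ge0_integralD//; last 4 first.
  - by move=> x _; rewrite -EFinM lee_fin mulr_ge0// ltW.
  - by apply: measurable_funeM; apply/measurable_EFinP; exact: measurable_indic.
  - by move=> x _; rewrite -EFinM lee_fin mulr_ge0// ltW.
  - by apply: measurable_funeM; apply/measurable_EFinP; exact: measurable_indic.
  rewrite !ge0_integralZl ?lee_fin ?(ltW l0) ?(ltW li0)//; last 2 first.
  - by apply/measurable_EFinP; exact: measurable_indic.
  - by apply/measurable_EFinP; exact: measurable_indic.
  rewrite !integral_indic// !setIT; apply: leeD2l; rewrite -[leRHS]mule1.
  by apply: lee_wpmul2l; rewrite ?lee_fin ?(ltW l0)// probability_le1.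
have := PQ (step A) (step (~` A)) (mstep _ mA) (mstep _ mC) (step0 _) (step0 _).
have fg x t : (0 < t)%R -> 2%:E <= t%:E * step A x + t^-1%:E * step (~` A) x.
  move=> t0; rewrite !stepE in_setC.
  have amgm (s : R) : (0 < s)%R -> (2 <= s + s^-1)%R.
    move=> s0; have -> : (s + s^-1 = 2 + (s - 1) ^+ 2 / s)%R.
      by field; rewrite gt_eqF.
    by rewrite lerDl divr_ge0 ?sqr_ge0 ?ltW.
  case: (x \in A) => /=; rewrite -!EFinM -EFinD lee_fin.
    by have := amgm _ (mulr_gt0 t0 li0); rewrite invfM invrK.
  by have := amgm _ (mulr_gt0 t0 l0); rewrite invfM.
move=> /(_ fg) h.
have {h} := le_trans h (leeD (int_step P A mA) (int_step Q _ mC)).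
have [pf qf] : P A \is a fin_num /\ Q (~` A) \is a fin_num.
  by split; exact: fin_num_measure.
rewrite -(fineK pf) -(fineK qf) -!EFinM -!EFinD !lee_fin => h.
move: h; rewrite addrACA -mulrDr -lerBlDr ler_pdivlMl// kE; lra.
Qed.

(** The density agrees almost everywhere with the Radon-Nikodym derivative. *)
Lemma ge0_integral_density (mu : {sigma_finite_measure set T -> \bar R})
    P (h : T -> \bar R) (p : T -> R) :
  measurable_fun setT h -> (forall x, 0 <= h x) ->
  measurable_fun setT p -> (forall x, 0 <= p x)%R ->
  (forall A, measurable A -> P A = \int[mu]_(x in A) (p x)%:E) ->
  \int[P]_x h x = \int[mu]_x (h x * (p x)%:E).
Proof.
move=> mh h0 mp p0 PE.
have ip : mu.-integrable setT (EFin \o p).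
  apply/integrableP; split; first exact/measurable_EFinP.
  under eq_integral do rewrite gee0_abs ?lee_fin ?p0//.
  by rewrite /= -PE// probability_setT ltry.
have Pmu : P `<< mu.
  apply/null_content_dominatesP => A mA muA0.
  change (P A = 0); rewrite PE//; apply: null_set_integral => //.
  exact/measurable_EFinP/measurable_funTS.
rewrite -(Radon_Nikodym_SigmaFinite.change_of_variables Pmu)//.
have mRN : measurable_fun setT (Radon_Nikodym_SigmaFinite.f P mu).
  exact: measurable_int (Radon_Nikodym_SigmaFinite.f_integrable Pmu).
apply: ae_eq_integral => //.
- exact: emeasurable_funM.
- by apply: emeasurable_funM => //; exact/measurable_EFinP.
- apply: ae_eqe_mul2l; apply: integral_ae_eq => //.
  + exact: Radon_Nikodym_SigmaFinite.f_integrable.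
  + exact/measurable_EFinP.
  + move=> A _ mA; rewrite -(Radon_Nikodym_SigmaFinite.f_integral Pmu)//.
    by rewrite -PE.
Qed.

(** The hypothesis on [f] and [g] gives
    [2 * Num.sqrt (p * q) <= p * f + q * g] pointwise, and
    [p + q = Num.sqrt (p * q) * (expR l + expR (- l))], where [2 * l] is the
    log-likelihood ratio, so that [expRD_expRN_le] bounds [p + q] by
    [2 * expR (r ^+ 2)] times that square root; it remains to integrate, [p]
    and [q] having mass [1]. *)
Lemma affinity_ge_density (mu : {sigma_finite_measure set T -> \bar R})
    P Q (p q : T -> R) (r : R) :
  measurable_fun setT p -> measurable_fun setT q ->
  (forall x, 0 < p x)%R -> (forall x, 0 < q x)%R ->
  (forall A, measurable A -> P A = \int[mu]_(x in A) (p x)%:E) ->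
  (forall A, measurable A -> Q A = \int[mu]_(x in A) (q x)%:E) ->
  (forall x, `|ln (q x / p x)| <= 2 * r)%R ->
  affinity_ge P Q (expR (- r ^+ 2)).
Proof.
move=> mp mq p0 q0 PE QE ratio f g mf mg f0 g0 fg.
have int1 (W : probability T R) (w : T -> R) :
    (forall A, measurable A -> W A = \int[mu]_(x in A) (w x)%:E) ->
    \int[mu]_x (w x)%:E = 1.
  by move=> <-//; exact: probability_setT.
have me (w : T -> R) : measurable_fun setT w -> measurable_fun setT (EFin \o w).
  by move=> mw; exact/measurable_EFinP.
have p0W x : (0 <= p x)%R by exact: ltW.
have q0W x : (0 <= q x)%R by exact: ltW.
rewrite (ge0_integral_density mf f0 mp p0W PE).
rewrite (ge0_integral_density mg g0 mq q0W QE) -ge0_integralD//; last 4 first.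
- by move=> x _; rewrite mule_ge0// lee_fin ltW.
- by apply: emeasurable_funM => //; exact: me.
- by move=> x _; rewrite mule_ge0// lee_fin ltW.
- by apply: emeasurable_funM => //; exact: me.
set k := expR _; have k0 : (0 < k)%R by exact: expR_gt0.
have -> : (2 * k)%:E = \int[mu]_x (k%:E * ((p x)%:E + (q x)%:E)).
  rewrite ge0_integralZl//; last 3 first.
  - by apply: emeasurable_funD; exact: me.
  - by move=> x _; rewrite -EFinD lee_fin addr_ge0 ?ltW.
  - by rewrite lee_fin ltW.
  rewrite ge0_integralD//.
  - by rewrite (int1 P)// (int1 Q)// -EFinD -EFinM mulrC.
  - by move=> x _; rewrite lee_fin ltW.
  - exact: me.
  - by move=> x _; rewrite lee_fin ltW.
  - exact: me.
apply: ge0_le_integral => //.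
- by move=> x _; rewrite -EFinD -EFinM lee_fin mulr_ge0 ?addr_ge0 ?ltW.
- by apply: measurable_funeM; apply: emeasurable_funD; exact: me.
- apply: emeasurable_funD; apply: emeasurable_funM => //; exact: me.
move=> x _.
(* [m] is the square root of [p x * q x] *)
pose l := (ln (q x / p x) / 2)%R; pose m := (p x * expR l)%R.
have m0 : (0 < m)%R by rewrite mulr_gt0 ?expR_gt0.
have pE : p x = (m * expR (- l))%R by rewrite /m -mulrA -expRD subrr expR0 mulr1.
have qE : q x = (m * expR l)%R.
  rewrite /m -mulrA -expRD -splitr lnK ?posrE ?divr_gt0//.
  by rewrite mulrC divfK// gt_eqF.
have lr : (l ^+ 2 <= r ^+ 2)%R.
  have := ratio x; rewrite -ler_pdivrMl// => h.
  rewrite -[(l ^+ 2)%R]real_normK ?num_real//.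
  have lE : `|l|%R = (2^-1 * `|ln (q x / p x)|)%R.
    by rewrite /l normrM mulrC ger0_norm.
  by rewrite lE lerXn2r ?nnegrE ?mulr_ge0// (le_trans _ h)// mulr_ge0.
apply: (@le_trans _ _ (m * 2)%:E).
  rewrite -EFinD -EFinM lee_fin pE qE -mulrDr mulrCA ler_pM2l// addrC.
  rewrite /k expRN mulrC ler_pdivrMr ?expR_gt0//.
  apply: (le_trans (expRD_expRN_le l)).
  by rewrite ler_pM2l// ler_expR.
(* the scale [expR (- l)] makes [m * t = p x] and [m / t = q x] *)
have := fg x (expR (- l)) (expR_gt0 _).
rewrite -(@lee_pmul2l _ m%:E)// ?lte_fin// => /le_trans; apply.
rewrite ge0_muleDr; last 2 first.
- by rewrite mule_ge0// lee_fin expR_ge0.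
- by rewrite mule_ge0// lee_fin invr_ge0 expR_ge0.
rewrite !muleA -!EFinM -pE -expRN opprK -qE.
by rewrite [in leLHS]muleC [X in _ + X <= _]muleC.
Qed.

End affinity.

(** Integrating the second variable turns [f] and [g] into functions of the
    first one that satisfy the hypothesis of [affinity_ge] up to the factor
    [k2]. *)
Lemma affinity_ge_pprod d1 d2 (T1 : measurableType d1) (T2 : measurableType d2)
    (R : realType) (P1 Q1 : probability T1 R) (P2 Q2 : probability T2 R)
    (k1 k2 : R) : 0 < k2 ->
  affinity_ge P1 Q1 k1 -> affinity_ge P2 Q2 k2 ->
  affinity_ge (pprod P1 P2) (pprod Q1 Q2) (k1 * k2).
Proof.
move=> k20 PQ1 PQ2 f g mf mg f0 g0 fg.
have k2i : 0 <= k2^-1 by rewrite invr_ge0 ltW.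
rewrite /pprod (fubini_tonelli1 f)//; rewrite (fubini_tonelli1 g)//.
rewrite /fubini_F.
pose F x := (\int[P2]_y f (x, y))%E; pose G x := (\int[Q2]_y g (x, y))%E.
have mF : measurable_fun setT F by exact: measurable_fun_fubini_tonelli_F.
have mG : measurable_fun setT G by exact: measurable_fun_fubini_tonelli_F.
have F0 x : (0 <= F x)%E by apply: integral_ge0.
have G0 x : (0 <= G x)%E by apply: integral_ge0.
have := PQ1 (fun x => k2^-1%:E * F x)%E (fun x => k2^-1%:E * G x)%E.
rewrite !ge0_integralZl// -ge0_muleDr ?integral_ge0//.
rewrite [(2 * (k1 * k2))%:E](_ : _ = (k2%:E * (2 * k1)%:E)%E); last first.
  by rewrite -EFinM; congr EFin; ring.
move=> h; rewrite -lee_pdivlMl//; apply: h.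
- exact: measurable_funeM.
- exact: measurable_funeM.
- by move=> x; rewrite mule_ge0.
- by move=> x; rewrite mule_ge0.
move=> x t t0; rewrite muleCA [X in (_ <= _ + X)%E]muleCA.
rewrite -ge0_muleDr; last 2 first.
- by rewrite mule_ge0// lee_fin ltW.
- by rewrite mule_ge0// lee_fin invr_ge0 ltW.
rewrite lee_pdivlMl// -EFinM mulrC.
apply: (affinity_ge_scaled PQ2) => //.
- by apply: measurableT_comp => //; exact: pair1_measurable.
- by apply: measurableT_comp => //; exact: pair1_measurable.
- by move=> y s s0; exact: fg.
Qed.

Lemma affinity_ge_iid d (T : measurableType d) (R : realType)
    (P Q : probability T R) (k : R) (n : nat) : 0 < k ->
  affinity_ge P Q k -> affinity_ge (iid_law P n) (iid_law Q n) (k ^+ n).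
Proof.
move=> k0 PQ; elim: n => [|n IHn] f g mf mg f0 g0 fg /=.
  rewrite !integral_dirac// diracT !mul1e expr0 mulr1.
  by have := fg [tuple] 1 ltr01; rewrite invr1 !mul1e.
rewrite !ge0_integral_distribution// exprS.
apply: (affinity_ge_pprod (exprn_gt0 n k0) PQ IHn) => //=.
- by apply: measurableT_comp => //; exact: measurable_tcons.
- by apply: measurableT_comp => //; exact: measurable_tcons.
- by move=> x t t0; exact: fg.
Qed.

(** * Wasserstein distance to a point mass *)

Section wasserstein_dirac.
Context {R : realType}.
Local Notation RB := (measurableTypeR R).
Local Open Scope ereal_scope.

(** The second coordinate is almost surely [t], so all couplings cost the
    same. *)
Lemma coupling_dirac_cost (m : probability RB R) (t : R)
    (pi : probability (RB * RB)%type R) : couplings m (dirac (t : RB)) pi ->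
  \int[pi]_z `|(z.1 : R) - z.2|%:E = \int[m]_x `|(x : R) - t|%:E.
Proof.
move=> cpl.
have mdist (u v : RB * RB -> RB) : measurable_fun setT u -> measurable_fun setT v ->
    measurable_fun setT (fun z => (`|(u z : R) - v z|%R)%:E).
  move=> mu mv; apply/measurable_EFinP.
  by apply: measurableT_comp => //; exact: measurable_funB.
have mdist1 : measurable_fun [set: RB] (fun x : RB => (`|(x : R) - t|%R)%:E).
  apply/measurable_EFinP.
  by apply: measurableT_comp => //; exact: measurable_funB.
transitivity (\int[pi]_z (`|(z.1 : R) - t|%R)%:E).
  apply: ge0_ae_eq_integral => //.
  - by apply: mdist; [exact: measurable_fst|exact: measurable_snd].
  - by apply: mdist => //; exact: measurable_fst.
  pose N : set RB := ~` [set t].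
  have mN : measurable N by apply: measurableC; exact: measurable_set1.
  exists (setT `*` N); split.
  - exact: measurableX.
  - apply: etrans (proj2 (cpl N mN)) _.
    by rewrite /= diracE memNset//= /N /=; exact.
  - by move=> z /=; apply: contra_notP => /not_andP[//|/contrapT ->].
transitivity (\int[pushforward pi fst]_x (`|(x : R) - t|%R)%:E).
  by rewrite ge0_integral_pushforward.
apply: eq_measure_integral => A mA _.
apply: etrans (proj1 (cpl A mA)); rewrite /pushforward; congr (pi _).
by apply/seteqP; split => z //= [].
Qed.

Lemma W1_dirac (m : probability RB R) (t : R) :
  W1 m (dirac (t : RB)) = \int[m]_x `|(x : R) - t|%:E.
Proof.
rewrite /W1 (_ : [set _ | _ in _] = [set \int[m]_x `|(x : R) - t|%:E]).
  exact: ereal_inf1.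
apply/seteqP; split => [_ [pi cpl <-]|_ ->] /=; first exact: coupling_dirac_cost.
have cpl : couplings m (dirac (t : RB)) (pprod m (dirac (t : RB))).
  move=> A mA; rewrite /= /pprod !product_measure1E//=.
  by rewrite !probability_setT mule1 mul1e.
by exists (pprod m (dirac (t : RB))) => //; exact: coupling_dirac_cost.
Qed.

Lemma measurable_W1_dirac n (e : n.-tuple RB -> pprobability RB R) (t : R) :
  estimator e -> measurable_fun setT (fun x => W1 (e x) (dirac (t : RB))).
Proof.
move=> [me _]; under eq_fun do rewrite W1_dirac.
apply: (@measurable_fun_integral_kernel _ _ _ _ _ (kprobability me)) => //.
  by move=> U mU; exact: measurable_kernel.
apply/measurable_EFinP.
by apply: measurableT_comp => //; exact: measurable_funB.
Qed.

Lemma W1_dirac_separated (m : probability RB R) (a : R) : (0 < a)%R ->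
  W1 m (dirac (- a : RB)%R) < a%:E -> a%:E <= W1 m (dirac (a : RB)).
Proof.
move=> a0; rewrite !W1_dirac => lta; rewrite leNgt; apply/negP => gta.
have mdist (t : R) : measurable_fun [set: RB] (fun x : RB => (`|(x : R) - t|%R)%:E).
  apply/measurable_EFinP.
  by apply: measurableT_comp => //; exact: measurable_funB.
have : (2 * a)%:E <= \int[m]_x (`|(x : R) - - a|%R)%:E
    + \int[m]_x (`|(x : R) - a|%R)%:E.
  rewrite -ge0_integralD//.
  have -> : (2 * a)%:E = \int[m]_x (cst (2 * a)%:E x).
    rewrite integral_cst// -[LHS]mule1; congr (_ * _).
    by apply/esym; exact: probability_setT.
  apply: ge0_le_integral => //.
  - by move=> x _; rewrite lee_fin mulr_ge0// ltW.
  - exact: emeasurable_funD.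
  - move=> x _; rewrite -EFinD lee_fin.
    have := ler_normD ((x : R) - - a)%R (- ((x : R) - a))%R.
    rewrite normrN; apply: le_trans.
    by apply: le_trans (ler_norm _); lra.
apply/negP; rewrite -ltNge (_ : (2 * a)%:E = a%:E + a%:E).
  exact: lteD.
by rewrite -EFinD; congr EFin; ring.
Qed.

End wasserstein_dirac.

(** * Affinity of shifted Laplace laws *)

Section laplace_location.
Context {R : realType}.
Local Notation RB := (measurableTypeR R).
Implicit Type b : {posnum R}.

Lemma obs_law_dirac b (t : R) (A : set RB) : measurable A ->
  obs_law b (dirac (t : RB)) A =
  (\int[lebesgue_measure]_(x in A) (laplace_pdf b (x - t))%:E)%E.
Proof.
move=> mA; apply: eq_integral => x _; rewrite /convolution_pdf.
rewrite integral_dirac//; first by rewrite diracT mul1e.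
apply/measurable_EFinP; apply: measurableT_comp.
  exact: measurable_laplace_pdf.
exact: measurable_funB.
Qed.

Lemma affinity_ge_laplace b (s t : R) :
  affinity_ge (obs_law b (dirac (s : RB))) (obs_law b (dirac (t : RB)))
    (expR (- (`|t - s| / (2 * b%:num)) ^+ 2)).
Proof.
have pos (u x : R) : 0 < laplace_pdf b (x - u).
  by rewrite /laplace_pdf mulr_gt0 ?expR_gt0// invr_gt0 mulr_gt0.
have mpdf (u : R) : measurable_fun [set: RB] (fun x : RB => laplace_pdf b (x - u)).
  apply: measurableT_comp; first exact: measurable_laplace_pdf.
  exact: measurable_funB.
apply: (@affinity_ge_density _ _ _ lebesgue_measure _ _
  (fun x : RB => laplace_pdf b (x - s)) (fun x : RB => laplace_pdf b (x - t))).
- exact: mpdf.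
- exact: mpdf.
- by move=> x; exact: pos.
- by move=> x; exact: pos.
- by move=> A mA; exact: obs_law_dirac.
- by move=> A mA; exact: obs_law_dirac.
move=> x.
have -> : laplace_pdf b (x - t) / laplace_pdf b (x - s) =
    expR ((`|x - s| - `|x - t|) / b%:num).
  rewrite /laplace_pdf -mulf_div divff ?mul1r ?invr_eq0 ?mulf_neq0//.
  by rewrite -expRN -expRD; congr expR; field.
rewrite expRK normrM [`|b%:num^-1|]ger0_norm//.
have -> : 2 * (`|t - s| / (2 * b%:num)) = `|t - s| / b%:num by field.
rewrite ler_pM2r ?invr_gt0//.
have -> : t - s = (x - s) - (x - t) by ring.
exact: ler_dist_dist.
Qed.

End laplace_location.

(** * The two-point argument *)

Section two_points.
Context {R : realType}.
Local Notation RB := (measurableTypeR R).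
Implicit Type b : {posnum R}.

Lemma prob_on_dirac (a t : R) : `|t| <= a -> prob_on a (dirac (t : RB)).
Proof.
by move=> ta; rewrite /prob_on/= diracE mem_set//= in_itv/= -ler_norml.
Qed.

Lemma measurable_W1_ge n (e : n.-tuple RB -> pprobability RB R) (t r : R) :
  estimator e -> measurable [set x | (r%:E <= W1 (e x) (dirac (t : RB)))%E].
Proof.
move=> ee; rewrite -[X in measurable X]setTI.
by apply: emeasurable_fun_c_infty => //; exact: measurable_W1_dirac.
Qed.

(** The test deciding for [a] when the estimate is at distance at least [a]
    from [dirac (- a)] errs under [dirac a] only if the estimate is also at
    distance at least [a] from [dirac a]. *)
Lemma two_point_bound (a c : R) b n (e : n.-tuple RB -> pprobability RB R) :
  0 < a -> 0 < c -> c * Num.sqrt n%:R <= b%:num -> estimator e ->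
  ((2^-1 * expR (- (2 * a ^+ 2 / c ^+ 2)))%:E <=
   sample_law b (dirac (- a : RB)%R) n
     [set x | a%:E <= W1 (e x) (dirac (- a : RB)%R)] +
   sample_law b (dirac (a : RB)) n
     [set x | a%:E <= W1 (e x) (dirac (a : RB))])%E.
Proof.
move=> a0 c0 cb ee.
set A := (X in (_ <= _ X + _)%E); set B := (X in (_ <= _ + _ X)%E).
have mA : measurable A by exact: measurable_W1_ge.
have mB : measurable B by exact: measurable_W1_ge.
set k := expR (- (`|a - - a| / (2 * b%:num)) ^+ 2).
have k0 : 0 < k by exact: expR_gt0.
have aff := affinity_ge_iid (n := n) k0 (affinity_ge_laplace b (- a) a).
have := affinity_ge_testing (exprn_gt0 n k0) aff mA.
have AB : ~` A `<=` B.
  by move=> x /negP; rewrite -ltNge; exact: W1_dirac_separated.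
move=> h; apply: (le_trans _ (le_trans h _)).
  rewrite lee_fin mulrC ler_pM2r//.
  rewrite -!expRM_natr ler_expR.
  rewrite (_ : `|a - - a| / (2 * b%:num) = a / b%:num); last first.
    rewrite opprK ger0_norm ?addr_ge0 ?ltW//; by field.
  have nb : n%:R * (a / b%:num) ^+ 2 <= a ^+ 2 / c ^+ 2.
    rewrite expr_div_n mulrCA ler_pM2l ?exprn_gt0// ler_pdivrMr ?exprn_gt0//.
    rewrite mulrC ler_pdivlMr ?exprn_gt0//.
    have -> : n%:R = Num.sqrt n%:R ^+ 2 :> R by rewrite sqr_sqrtr.
    by rewrite -exprMn mulrC lerXn2r ?nnegrE// mulr_ge0 ?sqrtr_ge0// ltW.
  by move: nb; rewrite -mulrA; lra.
by rewrite leeD2l// le_measure ?inE//; exact: measurableC.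
Qed.

Lemma risk_lower_bound (a c : R) (b : nat -> {posnum R})
    (e : forall n, n.-tuple RB -> pprobability RB R) :
  0 < a -> 0 < c -> (\forall n \near \oo, c * Num.sqrt n%:R <= (b n)%:num) ->
  estimator_sequence e ->
  ((4^-1 * expR (- (2 * a ^+ 2 / c ^+ 2)))%:E <=
    limn_einf (fun n => ereal_sup
      [set sample_law (b n) g n [set x | a%:E <= W1 (e n x) g]
        | g in prob_on a]))%E.
Proof.
move=> a0 c0 [N _ cb] ee; rewrite limn_einf_lim.
apply: lime_ge; first exact: is_cvg_einfs.
exists N => // m /= Nm; apply: le_ereal_inf_tmp => _ [n /= mn <-].
have bound := two_point_bound a0 c0 (cb n (leq_trans Nm mn)) (ee n).
set S := ereal_sup _.
have le_sup (t : R) : `|t| <= a ->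
    (sample_law (b n) (dirac (t : RB)) n
      [set x | a%:E <= W1 (e n x) (dirac (t : RB))] <= S)%E.
  move=> ta; apply: ereal_sup_ubound; exists (dirac (t : RB)) => //.
  exact: prob_on_dirac.
rewrite leNgt; apply/negP => Slt; move: bound; apply/negP; rewrite -ltNge.
apply: le_lt_trans (leeD (le_sup _ _) (le_sup _ _)) _.
- by rewrite normrN gtr0_norm.
- by rewrite gtr0_norm.
have -> : (2^-1 * expR (- (2 * a ^+ 2 / c ^+ 2)))%:E =
    ((4^-1 * expR (- (2 * a ^+ 2 / c ^+ 2)))%:E +
    (4^-1 * expR (- (2 * a ^+ 2 / c ^+ 2)))%:E)%E.
  by rewrite -EFinD; congr EFin; field.
exact: lteD.
Qed.

(** [risk_lower_bound] does not suffice: its supremum may be attained at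
    measures that vary with [n], whereas consistency is pointwise.  The two
    point masses of [two_point_bound] are the same for all [n]. *)
Lemma no_consistent_estimator (a c : R) (b : nat -> {posnum R})
    (e : forall n, n.-tuple RB -> pprobability RB R) :
  0 < a -> 0 < c -> (\forall n \near \oo, c * Num.sqrt n%:R <= (b n)%:num) ->
  estimator_sequence e -> ~ W1_consistent a b e.
Proof.
move=> a0 c0 cb ee cons.
have to0 (t : R) : `|t| <= a ->
    (sample_law (b n) (dirac (t : RB)) n
      [set x | (a%:E <= W1 (e n x) (dirac (t : RB)))%E] @[n --> \oo] --> 0%E).
  move=> ta; have a2 : 0 < a / 2 by rewrite divr_gt0.
  have := cons _ (prob_on_dirac ta) _ a2.
  apply: (@squeeze_cvge _ _ _ _ (cst 0%E)); last exact: cvg_cst.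
  apply: nearW => n; apply/andP; split; first exact: measure_ge0.
  apply: le_measure; rewrite ?inE; first exact: measurable_W1_ge.
    rewrite -[X in measurable X]setTI.
    by apply: emeasurable_fun_o_infty => //; exact: measurable_W1_dirac.
  by move=> x /=; apply: lt_le_trans; rewrite lte_fin ltr_pdivrMr// ltr_pMr// ltr1n.
have aN : `|- a| <= a by rewrite normrN gtr0_norm.
have aa : `|a| <= a by rewrite gtr0_norm.
have := cvgeD _ (to0 _ aN) (to0 _ aa); rewrite adde0 => /(_ _ isT) sum0.
set L := (2^-1 * expR (- (2 * a ^+ 2 / c ^+ 2)))%:E.
have : (L <= 0)%E.
  rewrite -(cvg_lim _ sum0)//; apply: lime_ge.
    by apply/cvg_ex; exists 0%E.
  by near=> n; apply: two_point_bound => //; near: n.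
by apply/negP; rewrite -ltNge lte_fin mulr_gt0 ?expR_gt0 ?invr_gt0.
Unshelve. all: by end_near. Qed.

End two_points.

Lemma bandwidth_lower_bound (R : realType) (a C : R) (b : nat -> {posnum R}) :
  0 < a ->
  (\forall n \near \oo, 2 * a / (b n)%:num <= C * n%:R `^ (- 2^-1)) ->
  exists2 c : R, 0 < c &
    \forall n \near \oo, c * Num.sqrt n%:R <= (b n)%:num.
Proof.
move=> a0 [N _ bC].
have sqrtE n : (0 < n)%N ->
    2 * a / (b n)%:num <= C * n%:R `^ (- 2^-1) ->
    2 * a * Num.sqrt n%:R <= C * (b n)%:num.
  move=> n0; rewrite powRN powR12_sqrt// ler_pdivrMr//.
  by rewrite mulrAC ler_pdivlMr// sqrtr_gt0 ltr0n.
have C0 : 0 < C.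
  have := sqrtE N.+1 isT (bC N.+1 (leqnSn N)).
  rewrite -(pmulr_lgt0 _ (_ : 0 < (b N.+1)%:num))//; apply: lt_le_trans.
  by rewrite !mulr_gt0// sqrtr_gt0 ltr0n.
exists (2 * a / C); first by rewrite divr_gt0 ?mulr_gt0.
exists (maxn N 1) => // n /=; rewrite geq_max => /andP[Nn n0].
by rewrite mulrAC ler_pdivrMr// [leRHS]mulrC; exact: sqrtE n0 (bC n Nn).
Qed.

Unset Implicit Arguments.

Theorem theorem5p4 (R : realType) (a : R) (ha : 0 < a)
    (b : nat -> {posnum R}) :
  (forall c : R, 0 < c ->
     (\forall n \near \oo, c * Num.sqrt n%:R <= (b n)%:num) ->
     [/\ forall e : (forall n : nat,
             n.-tuple (measurableTypeR R) -> pprobability (measurableTypeR R) R),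
           estimator_sequence e ->
           ((4^-1 * expR (- (2 * a ^+ 2 / c ^+ 2)))%:E <=
            limn_einf (fun n => ereal_sup
              [set sample_law (b n) g n [set x | (a%:E <= W1 (e n x) g)%E]
                | g in prob_on a]))%E,
         0 < 4^-1 * expR (- (2 * a ^+ 2 / c ^+ 2))
       & ~ exists e : (forall n : nat,
             n.-tuple (measurableTypeR R) -> pprobability (measurableTypeR R) R),
           estimator_sequence e /\ W1_consistent a b e])
  /\
  ((exists C : R, \forall n \near \oo,
      2 * a / (b n)%:num <= C * n%:R `^ (- 2^-1)) ->
   ~ exists e : (forall n : nat,
         n.-tuple (measurableTypeR R) -> pprobability (measurableTypeR R) R),
       estimator_sequence e /\ W1_consistent a b e).
Proof.
split=> [c c0 cb|[C bC]].
  split.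
  - by move=> e ee; exact: risk_lower_bound.
  - by rewrite mulr_gt0 ?expR_gt0 ?invr_gt0.
  - by move=> [e [ee]]; exact: (no_consistent_estimator ha c0 cb ee).
have [c c0 cb] := bandwidth_lower_bound ha bC.
by move=> [e [ee]]; exact: (no_consistent_estimator ha c0 cb ee).
Qed.
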